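(* Let $(\mathcal{X}, d)$ be a proper length metric space of covering dimension $n$, let $\mathscr{D} \subseteq \mathcal{X}$ be any finite subset of $\mathcal{X}$, and let $\delta > 0$. Then there exists a continuous map $f : \mathcal{X} \to \mathbb{E}^{2n+5}$ which satisfies: (1) for all $x,x'\in\mathcal{X}$, if $f(x)=f(x')$ then $d(x,x')<\delta$; (2) $d_{f(\mathcal{X})}(f(x),f(x')) = d(x,x')$ for all $x,x'\in\mathscr{D}$.
   Context: A length metric space is a metric space in which the distance between any two points equals the infimum of the lengths of paths joining them; it is proper if all closed balls are compact. $\mathbb{E}^{N}$ denotes $N$-dimensional Euclidean space. For points $p,q\in f(\mathcal{X})$, $d_{f(\mathcal{X})}(p,q)$ denotes the infimum of the (Euclidean) lengths of all paths contained in $f(\mathcal{X})$ from $p$ to $q$. *)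

(* Defs.v *)
From HB Require Import structures.
From mathcomp Require Import all_boot all_order all_algebra.
From mathcomp Require Import all_classical all_reals all_analysis.
Set Implicit Arguments.
Unset Strict Implicit.
Unset Printing Implicit Defensive.
Import Order.TTheory GRing.Theory Num.Theory.
Import numFieldNormedType.Exports.
Local Open Scope classical_set_scope.
Local Open Scope ring_scope.

(* The library distance on row vectors is the sup distance, which induces the
   same topology. *)
Definition euclid_dist (R : realType) (N : nat) (p q : 'rV[R]_N) : R :=
  Num.sqrt (\sum_(i < N) (p ord0 i - q ord0 i) ^+ 2).

(* Analogue of the library's [variation] and [total_variation] on [0, 1] for
   functions with values in a set equipped with a distance function [d]. *)
Definition path_variation (R : realType) (T : Type) (d : T -> T -> R)
    (g : R -> T) (s : seq R) : R :=
  let G := g \o nth 1 (0 :: s) in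
  \sum_(0 <= i < size s) d (G i) (G i.+1).

Definition path_length (R : realType) (T : Type) (d : T -> T -> R)
    (g : R -> T) : \bar R :=
  ereal_sup [set (path_variation d g s)%:E | s in itv_partition 0 1].

(* Only the values of [g] on [0, 1] matter. *)
Definition paths_in (R : realType) (T : topologicalType) (A : set T)
    (p q : T) : set (R -> T) :=
  [set g : R -> T | [/\ {within `[0 : R, 1], continuous g}, g 0 = p, g 1 = q
             & g @` `[0 : R, 1] `<=` A]].

(* The value is +oo when no path in [A] joins [p] to [q]. *)
Definition path_dist (R : realType) (T : topologicalType) (d : T -> T -> R)
    (A : set T) (p q : T) : \bar R :=
  ereal_inf [set path_length d g | g in paths_in A p q].

Definition length_space (R : realType) (X : metricType R) : Prop :=
  forall x y : X, path_dist mdist setT x y = (mdist x y)%:E.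

(* The library's [closed_ball] is the closure of the open ball, which may be
   smaller than the set used here. *)
Definition proper_space (R : realType) (X : metricType R) : Prop :=
  forall (x : X) (r : R), compact [set y | mdist x y <= r].

Definition open_cover (T : topologicalType) (U : set (set T)) : Prop :=
  (forall A, U A -> open A) /\ cover U id = setT.

Definition refines (T : Type) (V U : set (set T)) : Prop :=
  forall B, V B -> exists2 A, U A & B `<=` A.

Definition order_le (T : Type) (V : set (set T)) (k : nat) : Prop :=
  forall x : T, ([set A | V A /\ A x] #<= `I_k)%card.

(* "Covering dimension at most k - 1"; the shift by one gives the empty space
   dimension -1. *)
Definition covering_dim_lt (T : topologicalType) (k : nat) : Prop :=
  forall U : set (set T), open_cover U ->
    exists V : set (set T), [/\ open_cover V, refines V U & order_le V k].

Definition has_covering_dim (T : topologicalType) (n : nat) : Prop :=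
  covering_dim_lt T n.+1 /\ ~ covering_dim_lt T n.

(* Main.v *)
(* Let [A] be a map to R^(2n+1) with fibers of diameter < delta (partition of
   unity on a locally finite cover of order n+1, with vertices on the moment
   curve).  Embed in R^3 the complete graph on D, edge (i, j) having length
   d(p_i, p_j), so that its path distance restricts to d on D.  Cut each edge
   (i, j) into short pieces and realize the pieces over tiny disjoint balls of X
   centred near the successive points of a path from p_i to p_j; no geodesic is
   needed, since f may identify points closer than delta.  Then
   f = (t A, B, M t), where t >= 0 vanishes exactly on these balls and B sends the
   neighbourhood {t < 1} into the graph.  Where t <> 0 the fibers are controlled
   by A, where t = 0 by B.  The image of {t = 0} contains the graph, which gives
   the upper bound for the distances; a path in the image of length < M stays in
   {t < 1}, so its B-component is a path in the graph, which gives the lower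
   bound. *)

Require Import Defs.
From HB Require Import structures.
From mathcomp Require Import all_boot all_order all_algebra.
From mathcomp Require Import all_classical all_reals all_analysis.
From mathcomp Require Import ring lra.
Set Implicit Arguments.
Unset Strict Implicit.
Unset Printing Implicit Defensive.
Import Order.TTheory GRing.Theory Num.Theory.
Import numFieldNormedType.Exports.
Local Open Scope classical_set_scope.
Local Open Scope ring_scope.

(** * Length of paths *)

Lemma path_variation_rcons (R : realType) (T : Type) (d : T -> T -> R)
    (g : R -> T) (s : seq R) (v : R) :
  path_variation d g (rcons s v) =
  path_variation d g s + d (g (last 0 s)) (g v).
Proof.
rewrite /path_variation size_rcons big_nat_recr//=; congr (_ + d (g _) (g _)).
- apply: eq_big_nat => i /andP[_ ilt].
  by rewrite -rcons_cons !nth_rcons/= ltnS (ltnW ilt) ilt.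
- by rewrite -rcons_cons nth_rcons/= ltnSn (nth_last 1 (0 :: s)).
- by rewrite nth_rcons ltnn eqxx.
Qed.

Lemma path_length_le (R : realType) (T : Type) (d : T -> T -> R)
    (g : R -> T) (c : R) :
  (forall s t : R, 0 <= s -> s <= t -> t <= 1 -> d (g s) (g t) <= c * (t - s)) ->
  (path_length d g <= c%:E)%E.
Proof.
move=> lip; apply: ge_ereal_sup => _ [s [sp /eqP sl] <-]; rewrite lee_fin.
suff: last 0 s <= 1 -> 0 <= last 0 s /\ path_variation d g s <= c * last 0 s.
  by rewrite sl mulr1 => /(_ (lexx _))[].
elim/last_ind: s sp {sl} => [|s v IH].
  by rewrite /path_variation big_nil mulr0.
rewrite rcons_path last_rcons => /andP[sp lv] v1.
have [l0 var] := IH sp (ltW (lt_le_trans lv v1)).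
split; first exact: le_trans (ltW lv).
rewrite path_variation_rcons (_ : c * v = c * last 0 s + c * (v - last 0 s)).
  by rewrite lerD// lip// ltW.
by ring.
Qed.

(** The partition with the points 0, s and 1 suffices. This bounds from below the length of a path
    that leaves the set {t < 1}. *)
Lemma dist_le_path_length (R : realType) (T : Type) (d : T -> T -> R)
    (g : R -> T) (s : R) : (forall x y, 0 <= d x y) -> 0 < s -> s <= 1 ->
  ((d (g 0) (g s))%:E <= path_length d g)%E.
Proof.
move=> d0 s0; rewrite le_eqVlt => /predU1P[->|s1].
  apply: ereal_sup_ubound; exists [:: 1]; first exact/itv_partition1/ltr01.
  by rewrite /path_variation big_nat1.
apply: (@le_trans _ _ (path_variation d g [:: s; 1])%:E).
  by rewrite lee_fin /path_variation big_nat_recr//= big_nat1 lerDl.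
apply: ereal_sup_ubound; exists [:: s; 1] => //.
by rewrite /itv_partition/= s0 s1.
Qed.

(* The condition compares [phi u] only with the value at the centre [s], so it
   holds at a corner of a polygonal line when [phi] is affine on each side. *)
Lemma variation_le_path_length (R : realType) (T : Type) (d : T -> T -> R)
    (g : R -> T) (phi : R -> R) :
  (forall x y, d x y = d y x) ->
  (forall s : R, 0 <= s <= 1 -> exists2 e : R, 0 < e & forall u : R, 0 <= u <= 1 ->
     `|u - s| < e -> `|phi u - phi s| <= d (g u) (g s)) ->
  (`|phi 1 - phi 0|%:E <= path_length d g)%E.
Proof.
move=> dC loc.
(* Continuous induction on [0, 1]: [E] collects the times up to which some partition dominates the
   change of [phi]. It contains 0, its supremum belongs to it, and that supremum cannot be smaller
   than 1. *)
pose E := [set s : R | 0 <= s <= 1 /\ exists l : seq R, [/\ path <%R 0 l, last 0 l = s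
  & `|phi s - phi 0| <= path_variation d g l]].
have E0 : E 0.
  split; first by rewrite lexx ler01.
  by exists [::]; rewrite /path_variation big_nil subrr normr0.
have extend (s u : R) : E s -> s < u -> u <= 1 ->
    `|phi u - phi s| <= d (g s) (g u) -> E u.
  move=> [/andP[s0 _] [l [lp ls lv]]] su u1 dsu.
  split; first by rewrite u1 (le_trans s0 (ltW su)).
  exists (rcons l u); split; rewrite ?last_rcons ?rcons_path ?lp ?ls//.
  rewrite path_variation_rcons ls (le_trans _ (lerD lv dsu))//.
  rewrite (_ : phi u - phi 0 = (phi s - phi 0) + (phi u - phi s)) ?ler_normD//.
  by ring.
have supE : has_sup E by split; [exists 0 | exists 1 => s [/andP[]]].
pose m := sup E.
have m0 : 0 <= m by apply: ub_le_sup => //; case: supE.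
have m1 : m <= 1 by apply: ge_sup; [exists 0 | move=> s [/andP[]]].
have [e e0 He] := loc m (introT andP (conj m0 m1)).
(* The local condition is always centred at [m]: here for a point of [E] just below it, at the end
   for a point just above it. *)
have Em : E m.
  have [s Es ms] := sup_adherent e0 supE.
  have := ub_le_sup supE.2 Es; rewrite -/m le_eqVlt => /predU1P[<-//|sm].
  have s01 := Es.1.
  apply: (extend s) => //.
  rewrite distrC He// ltr_norml.
  by move: ms; rewrite -/m => ms; apply/andP; split; lra.
suff m1' : m = 1.
  case: Em => _ [l [lp ls lv]].
  apply: (@le_trans _ _ (path_variation d g l)%:E).
    by rewrite lee_fin -m1'.
  apply: ereal_sup_ubound; exists l => //; split; [exact: lp|].
  by rewrite ls m1'.
apply/eqP; rewrite eq_le m1 leNgt; apply/negP => ml1.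
pose u := Num.min 1 (m + e / 2).
have mu : m < u by rewrite lt_min ml1 ltrDl divr_gt0.
have u1 : u <= 1 by rewrite ge_min lexx.
suff /(ub_le_sup supE.2) : E u by rewrite leNgt mu.
apply: (extend m) => //; rewrite dC He ?u1 ?(le_trans m0 (ltW mu))//.
rewrite gtr0_norm ?subr_gt0// ltrBlDl gt_min.
by rewrite [X in _ || X]ltrD2l [X in _ || X]gtr_pMr ?invf_lt1 ?ltr1n ?orbT.
Qed.

(** * A complete graph in space with prescribed edge lengths *)

Lemma fin_pos_lbound (R : realType) (I : finType) (F : I -> R) :
  (forall i, 0 < F i) -> exists2 h : R, 0 < h & forall i, h <= F i.
Proof.
move=> F0; exists (\big[Num.min/1]_i F i); last by move=> i; exact: bigmin_le_cond.
by apply: lt_bigmin => // i _; exact: F0.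
Qed.

Lemma euclid_distC (R : realType) N (p q : 'rV[R]_N) :
  euclid_dist p q = euclid_dist q p.
Proof.
by congr Num.sqrt; apply: eq_bigr => i _; rewrite -sqrrN opprB.
Qed.

Lemma euclid_dist_ge0 (R : realType) N (p q : 'rV[R]_N) : 0 <= euclid_dist p q.
Proof. exact: sqrtr_ge0. Qed.

Lemma coord_le_euclid_dist (R : realType) N (p q : 'rV[R]_N) i :
  `|p ord0 i - q ord0 i| <= euclid_dist p q.
Proof.
rewrite -sqrtr_sqr ler_wsqrtr// (bigD1 i)//= lerDl.
by apply: sumr_ge0 => j _; exact: sqr_ge0.
Qed.

Lemma euclid_dist_row_mx (R : realType) m n (p p' : 'rV[R]_m) (q q' : 'rV[R]_n) :
  euclid_dist (row_mx p q) (row_mx p' q') =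
  Num.sqrt (euclid_dist p p' ^+ 2 + euclid_dist q q' ^+ 2).
Proof.
rewrite /euclid_dist !sqr_sqrtr ?sumr_ge0//; try by move=> i _; exact: sqr_ge0.
congr Num.sqrt; rewrite big_split_ord/=.
by congr (_ + _); apply: eq_bigr => i _; rewrite ?row_mxEl ?row_mxEr.
Qed.

Lemma euclid_distxx (R : realType) N (p : 'rV[R]_N) : euclid_dist p p = 0.
Proof.
by rewrite /euclid_dist big1 ?sqrtr0// => i _; rewrite subrr expr0n.
Qed.

Lemma cvg_rV (R : realType) (T : Type) (F : set_system T) (FF : Filter F) N
    (f : T -> 'rV[R]_N) (l : 'rV[R]_N) :
  (forall i, f x ord0 i @[x --> F] --> l ord0 i) -> f @ F --> l.
Proof.
move=> fl; apply/cvg_ballP => e e0.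
have : \forall x \near F, forall i, ball (l ord0 i) e (f x ord0 i).
  by apply: filter_forall => i; move/cvg_ballP : (fl i); apply.
apply: filterS => x fx; split=> // i j.
by rewrite (ord1 i); exact: fx.
Qed.

Lemma lipschitz_path_continuous (R : realType) N (b : R -> 'rV[R]_N) (c : R) :
  (forall s t : R, euclid_dist (b s) (b t) <= c * `|s - t|) -> continuous b.
Proof.
move=> lip s; apply: cvg_rV => i; apply/cvgrPdist_lt => e e0.
have c0 : 0 < `|c| + 1 by rewrite ltr_wpDl.
near=> t; rewrite (le_lt_trans (coord_le_euclid_dist _ _ _))//.
rewrite (le_lt_trans (lip _ _))//.
apply: (@le_lt_trans _ _ ((`|c| + 1) * `|s - t|)).
  by rewrite ler_wpM2r// (le_trans (ler_norm c))// lerDl.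
rewrite mulrC -ltr_pdivlMr//.
near: t; apply: (@cvgr_dist_lt _ _ _ (nbhs s) _ id s) => //.
by rewrite divr_gt0.
Unshelve. all: by end_near. Qed.

(* Every ordered pair of vertices has its own edge, parametrized on [0, 1] with
   constant speed by two segments meeting at time 1/2.  The last clause says that
   edges only meet at common end points: it is stated for a family [G] of paths
   joining the same end points, because such families are what is transported
   along the graph. *)
Definition graph_embedding (R : realType) (k : nat) (w : 'I_k -> 'I_k -> R)
    (b : 'I_k -> 'I_k -> R -> 'rV[R]_3) : Prop :=
  [/\ forall i j, b i j 0 = b i i 0 /\ b i j 1 = b j j 0,
      forall i s, b i i s = b i i 0,
      forall i j (s t : R), euclid_dist (b i j s) (b i j t) <= w i j * `|s - t|,
      forall i j (s t : R), 0 <= (2 * s - 1) * (2 * t - 1) ->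
        euclid_dist (b i j s) (b i j t) = w i j * `|s - t|
    & forall i j i' j' (s s' : R), 0 <= s <= 1 -> 0 <= s' <= 1 ->
        b i j s = b i' j' s' ->
        forall (T : Type) (a : 'I_k -> T) (G : 'I_k -> 'I_k -> R -> T),
          (forall i j, G i j 0 = a i /\ G i j 1 = a j) ->
          (forall i s, G i i s = a i) -> G i j s = G i' j' s'].

(* The vertices lie on the z-axis and each edge is a tent in its own half-plane
   bounded by that axis. *)
Lemma complete_graph_embedding (R : realType) (k : nat) (w : 'I_k -> 'I_k -> R) :
  (forall i, w i i = 0) -> (forall i j, i != j -> 0 < w i j) ->
  exists b, graph_embedding w b.
Proof.
move=> w0 wgt0.
have wge0 i j : 0 <= w i j.
  by have [->|/wgt0/ltW//] := eqVneq i j; rewrite w0.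
have [h h0 hw] : exists2 h : R, 0 < h & forall i j, i != j -> h <= w i j.
  have [|h h0 hF] := @fin_pos_lbound R ('I_k * 'I_k)%type
    (fun ij => if ij.1 == ij.2 then 1 else w ij.1 ij.2).
    by move=> [i j]/=; case: ifPn => // /wgt0.
  by exists h => // i j ij; have := hF (i, j); rewrite /= (negbTE ij).
(* The heights are distinct and spread over less than [h], so the vertical gap between two vertices
   is shorter than their edge. *)
pose z (i : 'I_k) : R := h / k.+1%:R * i%:R.
have h1 : 0 < h / k.+1%:R by rewrite divr_gt0// ltr0n.
have z_inj : injective z.
  by move=> i j /(mulfI (lt0r_neq0 h1))/eqP; rewrite eqr_nat => /eqP/ord_inj.
have zw i j : (z i - z j) ^+ 2 <= w i j ^+ 2 ?= iff (i == j).
  have [->|ij] := eqVneq i j.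
    by rewrite subrr w0; split; rewrite ?lexx ?eqxx.
  suff lt : (z i - z j) ^+ 2 < w i j ^+ 2 by split; rewrite ?ltW ?lt_eqF.
  rewrite -(real_normK (num_real (z i - z j))) ltr_pXn2r ?nnegrE//.
  apply: lt_le_trans (hw _ _ ij).
  rewrite /z -mulrBr normrM gtr0_norm// -mulrA gtr_pMr// mulrC.
  rewrite ltr_pdivrMr ?ltr0n// mul1r ltr_norml.
  have := ltn_ord i; have := ltn_ord j; rewrite -!(ltr_nat R) => jk ik.
  have i0 : 0 <= (i : nat)%:R :> R by [].
  have j0 : 0 <= (j : nat)%:R :> R by [].
  by rewrite -natr1; apply/andP; split; lra.
(* The rank of the ordered pair serves as a slope, so every edge has its own half-plane; [c]
   normalizes the horizontal direction to a unit vector. *)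
pose q (i j : 'I_k) : R := (enum_rank (i, j) : nat)%:R.
pose c (i j : 'I_k) : R := (Num.sqrt (1 + q i j ^+ 2))^-1.
have q1 i j : 0 < 1 + q i j ^+ 2 by rewrite ltr_pwDl// sqr_ge0.
have c0 i j : 0 < c i j by rewrite invr_gt0 sqrtr_gt0.
have cq i j : c i j ^+ 2 * (1 + q i j ^+ 2) = 1.
  by rewrite exprVn sqr_sqrtr ?ltW// mulVf// gt_eqF.
(* Distance from the apex of the tent to the axis; by Pythagoras each of the two segments has length
   [w i j / 2]. *)
pose rho i j : R := Num.sqrt (w i j ^+ 2 - (z i - z j) ^+ 2) / 2.
have rho0 i j : 0 <= rho i j by rewrite divr_ge0.
have rho_eq0 i j : rho i j = 0 -> i = j.
  move/eqP; rewrite mulf_eq0 invr_eq0 pnatr_eq0 orbF sqrtr_eq0 subr_le0.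
  by rewrite (ge_leif (zw i j)) => /eqP.
have rhoii i : rho i i = 0 by rewrite /rho w0 subrr subrr sqrtr0 mul0r.
have rhoE i j : (2 * rho i j) ^+ 2 + (z i - z j) ^+ 2 = w i j ^+ 2.
  rewrite /rho mulrCA mulfV ?pnatr_eq0// mulr1 sqr_sqrtr ?subrK//.
  by rewrite subr_ge0; case: (zw i j).
pose r i j (s : R) : R := rho i j * (1 - `|2 * s - 1|).
pose zz i j (s : R) : R := (1 - s) * z i + s * z j.
pose b i j s : 'rV[R]_3 :=
  \row_l nth 0 [:: r i j s * c i j; r i j s * c i j * q i j; zz i j s] l.
have bE i j s t : euclid_dist (b i j s) (b i j t) =
    Num.sqrt ((r i j s - r i j t) ^+ 2 + ((z i - z j) * (s - t)) ^+ 2).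
  rewrite /euclid_dist !big_ord_recr big_ord0 /= !mxE/= add0r; congr Num.sqrt.
  rewrite -[(r i j s - r i j t) ^+ 2]mulr1 -(cq i j) /zz; ring.
have wE i j (s t : R) : w i j * `|s - t| =
    Num.sqrt ((2 * rho i j * (s - t)) ^+ 2 + ((z i - z j) * (s - t)) ^+ 2).
  rewrite -{1}(ger0_norm (wge0 i j)) -normrM -sqrtr_sqr exprMn -rhoE.
  by congr Num.sqrt; ring.
exists b; split.
- move=> i j; split; apply/rowP => l; rewrite !mxE /r /zz.
    by rewrite mulr0 sub0r normrN1 subrr !mulr0 !mul0r !subr0 !mul1r.
  rewrite mulr1 mulr0 sub0r normrN1 subrr (_ : 2 - 1 = 1) ?normr1; last by ring.
  by rewrite !subrr !mulr0 !mul0r !subr0 !mul1r add0r addr0.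
- move=> i s; apply/rowP => l; rewrite !mxE /r /zz rhoii !mul0r subr0 mul1r.
  by rewrite -mulrDl subrK mul1r addr0.
- move=> i j s t; rewrite bE wE ler_wsqrtr// lerD2r.
  rewrite -(real_normK (num_real (r i j s - _))).
  rewrite -(real_normK (num_real (2 * _ * _))).
  rewrite ler_pXn2r ?nnegrE//.
  have -> : r i j s - r i j t = rho i j * (`|2 * t - 1| - `|2 * s - 1|).
    by rewrite /r; ring.
  rewrite (_ : 2 * rho i j * (s - t) = rho i j * (2 * (s - t))); last by ring.
  rewrite !(normrM (rho i j)) ler_wpM2l//.
  rewrite (le_trans (ler_dist_dist _ _))// distrC.
  by rewrite (_ : 2 * s - 1 - (2 * t - 1) = 2 * (s - t))//; ring.
- move=> i j s t st; rewrite bE wE; congr Num.sqrt; congr (_ + _).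
  rewrite /r.
  have [s0|s0] := leP 0 (2 * s - 1); have [t0|t0] := leP 0 (2 * t - 1).
  + by rewrite !ger0_norm//; ring.
  + have s2 : 2 * s - 1 = 0 by apply/le_anti; rewrite s0 -(nmulr_lge0 _ t0) st.
    rewrite s2 normr0 ltr0_norm// (_ : s = 2^-1); first by field.
    by move: s2; lra.
  + have t2 : 2 * t - 1 = 0 by apply/le_anti; rewrite t0 -(nmulr_rge0 _ s0) st.
    rewrite t2 normr0 ltr0_norm// (_ : t = 2^-1); first by field.
    by move: t2; lra.
  + by rewrite !ltr0_norm//; ring.
- move=> i j i' j' s s' s01 s01' bb T a G Ga Gii.
  have vtx i0 j0 t : 0 <= t <= 1 -> r i0 j0 t = 0 ->
      exists v, zz i0 j0 t = z v /\ G i0 j0 t = a v.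
    move=> /andP[t0 t1] /eqP; rewrite mulf_eq0 => /orP[/eqP/rho_eq0 <-|].
      by exists i0; rewrite Gii /zz -mulrDl subrK mul1r.
    case: (ger0P (2 * t - 1)) => t2 /eqP t3.
      have -> : t = 1 by lra.
      by exists j0; rewrite (Ga i0 j0).2 /zz subrr mul0r add0r mul1r.
    have -> : t = 0 by lra.
    by exists i0; rewrite (Ga i0 j0).1 /zz subr0 mul1r mul0r addr0.
  have e0 := congr1 (fun v : 'rV_3 => v ord0 (Ordinal (isT : 0 < 3)%N)) bb.
  have e1 := congr1 (fun v : 'rV_3 => v ord0 (Ordinal (isT : 1 < 3)%N)) bb.
  have e2 := congr1 (fun v : 'rV_3 => v ord0 (Ordinal (isT : 2 < 3)%N)) bb.
  rewrite !mxE/= in e0 e1 e2.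
  have [r0|r0] := eqVneq (r i j s) 0.
    have r0' : r i' j' s' = 0.
      apply/eqP; rewrite -[_ == _](mulIr_eq0 _ (mulIf (lt0r_neq0 (c0 i' j')))).
      by rewrite -e0 r0 mul0r.
    have [v [zv ->]] := vtx _ _ _ s01 r0.
    have [v' [zv' ->]] := vtx _ _ _ s01' r0'.
    by congr a; apply: z_inj; rewrite -zv -zv'.
  have rc0 : r i j s * c i j != 0 by rewrite mulf_neq0// gt_eqF.
  have : q i j = q i' j' by apply: (mulfI rc0); rewrite e1 e0.
  move/eqP; rewrite eqr_nat => /eqP/ord_inj/enum_rank_inj[? ?]; subst i' j'.
  suff -> : s = s' by [].
  (* On a common edge off the axis the height determines the parameter, because distinct vertices
     have distinct heights. *)
  have ij : i != j.
    by apply: contra_neq r0 => <-; rewrite /r rhoii mul0r.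
  have zz0 : z j - z i != 0 by rewrite subr_eq0 (inj_eq z_inj) eq_sym.
  apply: (mulIf zz0); apply: (addrI (z i)).
  transitivity (zz i j s); first by rewrite /zz; ring.
  by rewrite e2 /zz; ring.
Qed.

(** * Maps onto a graph near finitely many points *)

(** Truncation to [0, 1], written with absolute values so that continuity is immediate and sign
    cases leave linear arithmetic. *)
Definition clamp (R : realType) (v : R) : R := (1 + `|v| - `|v - 1|) / 2.

Lemma clamp_itv (R : realType) (v : R) : 0 <= clamp v <= 1.
Proof.
by rewrite /clamp; case: (ger0P v); case: (ger0P (v - 1)) => ? ?;
  apply/andP; split; lra.
Qed.

Lemma clamp_id (R : realType) (v : R) : 0 <= v <= 1 -> clamp v = v.
Proof.
by rewrite /clamp => ?; case: (ger0P v); case: (ger0P (v - 1)) => ? ?; lra.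
Qed.

Lemma clamp_ge1 (R : realType) (v : R) : 1 <= v -> clamp v = 1.
Proof.
by rewrite /clamp => ?; case: (ger0P v); case: (ger0P (v - 1)) => ? ?; lra.
Qed.

Lemma clamp_le0 (R : realType) (v : R) : v <= 0 -> clamp v = 0.
Proof.
by rewrite /clamp => ?; case: (ger0P v); case: (ger0P (v - 1)) => ? ?; lra.
Qed.

Lemma clamp_eq0 (R : realType) (v : R) : clamp v = 0 -> v <= 0.
Proof.
by rewrite /clamp; case: (ger0P v); case: (ger0P (v - 1)) => ? ?; lra.
Qed.

Lemma clamp_continuous (R : realType) : continuous (@clamp R).
Proof.
move=> v; apply: cvgMr_tmp; apply: cvgB.
  by apply: cvgD; [exact: cvg_cst | apply: cvg_norm; exact: cvg_id].
by apply: cvg_norm; apply: cvgB; [exact: cvg_id | exact: cvg_cst].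
Qed.

Lemma lipschitz_continuous (R : realType) (X : metricType R) (f : X -> R) :
  (forall x y, `|f x - f y| <= mdist x y) -> continuous f.
Proof.
move=> lip x; apply/cvgrPdist_lt => e e0.
near=> y; apply: (le_lt_trans (lip x y)).
by near: y; have := nbhsx_ballx x e e0; rewrite ballEmdist.
Unshelve. all: by end_near. Qed.

Lemma mdist_continuous (R : realType) (X : metricType R) (c : X) :
  continuous (mdist c).
Proof.
apply: lipschitz_continuous => x y; rewrite ler_norml.
have := metric_triangle c x y; have := metric_triangle c y x.
by rewrite (metric_sym y x) => ? ?; apply/andP; split; lra.
Qed.

(** Near [c k], the distance to [c k] divided by a small radius is the parameter of [h k]. All
    parameters occur because spheres are nonempty up to the distance of another point; a second
    centre [c k'] is such a point. *)
Lemma graph_cells (R : realType) (X : metricType R) (I : finType) (c : I -> X)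
    (h : I -> R -> 'rV[R]_3) (eta : R) :
  injective c -> 0 < eta -> (forall k, continuous (h k)) ->
  (forall (x y : X) (r : R), 0 <= r <= mdist x y -> exists z, mdist x z = r) ->
  exists (B : X -> 'rV[R]_3) (t : X -> R),
  [/\ continuous B /\ continuous t,
      forall x, t x = 0 -> exists k (u : R),
        [/\ 0 <= u <= 1, mdist (c k) x < eta & B x = h k u],
      forall x, t x < 1 -> exists k (u : R), 0 <= u <= 1 /\ B x = h k u,
      forall k, t (c k) = 0 /\ B (c k) = h k 0
    & forall k k' (u : R), k != k' -> 0 <= u <= 1 ->
        exists x, t x = 0 /\ B x = h k u].
Proof.
move=> c_inj eta0 hc spheres.
(* With centres [6 * rho] apart, a point within [2 * rho] of one centre is at least [4 * rho] from
   the others, whose weights in [B] vanish from [3 * rho] on. *)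
have [rho rho0 [rho_eta rhoc]] : exists2 rho : R, 0 < rho &
    rho < eta /\ forall k k', k != k' -> 6 * rho <= mdist (c k) (c k').
  have [|r r0 hr] := @fin_pos_lbound R (I * I)%type
    (fun kk => if kk.1 == kk.2 then 1 else mdist (c kk.1) (c kk.2)).
    move=> [k k']/=; case: ifPn => // kk'.
    by rewrite mdist_gt0 (inj_eq c_inj).
  exists (Num.min (r / 6) (eta / 2)).
    by rewrite lt_min !divr_gt0.
  split; first by rewrite gt_min [X in _ || X]gtr_pMr ?invf_lt1 ?ltr1n ?orbT.
  move=> k k' kk'; have := hr (k, k'); rewrite /= (negbTE kk'); apply: le_trans.
  by rewrite mulrC -ler_pdivlMr ?ge_min ?lexx.
pose de k x : R := mdist (c k) x / rho.
have de_tri k k' x : k != k' -> 6 <= de k x + de k' x.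
  move=> /rhoc; rewrite -mulrDl ler_pdivlMr// => /le_trans; apply.
  by rewrite (metric_sym (c k') x) metric_triangle.
have de_cont k : continuous (de k).
  by move=> x; apply: cvgMr_tmp; exact: mdist_continuous.
pose B x : 'rV[R]_3 := \sum_k clamp (3 - de k x) *: h k (clamp (de k x)).
(* [t] vanishes within [rho] of a centre, and [t x < 1] forces [x] within [2 * rho] of one, where
   [B] follows a single [h k]. *)
pose t x : R := \prod_k clamp (de k x - 1).
have near_cell k x : de k x <= 2 -> B x = h k (clamp (de k x)).
  move=> d2; rewrite /B (bigD1 k)//= big1 ?addr0 => [|k' kk'].
    by rewrite clamp_ge1 ?scale1r//; lra.
  rewrite clamp_le0 ?scale0r//.
  by have := de_tri k' k x kk'; lra.
have cellt k x : de k x <= 1 -> t x = 0.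
  by move=> d1; rewrite /t (bigD1 k)//= clamp_le0 ?mul0r// subr_le0.
exists B, t; split.
- split.
    move=> x; apply: cvg_rV => i.
    rewrite /B (_ : (fun y => _) = (fun y =>
      \sum_k (clamp (3 - de k y) * h k (clamp (de k y)) ord0 i))); last first.
      by apply/funext => y; rewrite summxE; apply: eq_bigr => k _; rewrite mxE.
    rewrite summxE; under [X in _ --> X]eq_bigr do rewrite mxE.
    apply: cvg_big => [|k _]; first exact: add_continuous.
    apply: cvgM.
      apply: (@continuous_comp _ _ _ (fun y => 3 - de k y) (@clamp R)).
        by apply: cvgB; [exact: cvg_cst | exact: de_cont].
      exact: clamp_continuous.
    apply: (@continuous_comp _ _ _ (fun y => h k (clamp (de k y)))
      (fun p : 'rV_3 => p ord0 i)); last exact: coord_continuous.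
    apply: (@continuous_comp _ _ _ (fun y => clamp (de k y)) (h k)); last exact: hc.
    apply: (@continuous_comp _ _ _ (de k) (@clamp R)); first exact: de_cont.
    exact: clamp_continuous.
  move=> x; apply: cvg_big => [|k _]; first exact: mul_continuous.
  apply: (@continuous_comp _ _ _ (fun y => de k y - 1) (@clamp R)).
    by apply: cvgB; [exact: de_cont | exact: cvg_cst].
  exact: clamp_continuous.
- move=> x /eqP; rewrite prodf_seq_eq0 => /hasP[k _ /=/eqP/clamp_eq0].
  rewrite subr_le0 => d1; exists k, (clamp (de k x)); split.
  + exact: clamp_itv.
  + by apply: le_lt_trans rho_eta; rewrite -[rho]mul1r -ler_pdivrMr.
  + by apply: near_cell; rewrite (le_trans d1)// ler1n.
- move=> x t1.
  have [k dk] : exists k, de k x < 2.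
    apply/not_existsP => dk; move: t1; rewrite /t big1 ?ltxx// => k _.
    rewrite clamp_ge1//; have /negP := dk k; rewrite -leNgt; lra.
  exists k, (clamp (de k x)); split; first exact: clamp_itv.
  exact/near_cell/ltW.
- move=> k; have dk : de k (c k) = 0 by rewrite /de mdistxx mul0r.
  split; first by apply: (cellt k); rewrite dk.
  by rewrite (near_cell k) ?dk// clamp_le0.
- move=> k k' u kk' u01; have /andP[u0 u1] := u01.
  have [|x xE] := spheres (c k) (c k') (u * rho).
    rewrite mulr_ge0 ?(ltW rho0)//= (le_trans _ (rhoc _ _ kk'))//.
    rewrite ler_wpM2r ?(ltW rho0)//; lra.
  have dk : de k x = u by rewrite /de xE mulfK ?gt_eqF.
  exists x; split; first by apply: (cellt k); rewrite dk.
  by rewrite (near_cell k) ?dk ?clamp_id//; lra.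
Qed.

(** * Paths and spheres in length spaces *)

Lemma within_continuous_ball (R : realType) (T : pseudoMetricType R)
    (g : R -> T) (s e : R) : {within `[0 : R, 1], continuous g} ->
  0 <= s <= 1 -> 0 < e ->
  exists2 r : R, 0 < r &
    forall u : R, 0 <= u <= 1 -> `|s - u| < r -> ball (g s) e (g u).
Proof.
move=> gc s01 e0.
have sI : (`[0, 1]%classic : set R) s by rewrite /= in_itv.
have /subspace_continuousP/(_ _ sI _ (nbhsx_ballx (g s) e e0)) := gc.
move=> /nbhs_ballP[r r0 Hr].
by exists r => // u u01 su; apply: Hr => //=; rewrite in_itv.
Qed.

(** The distance is finite, whereas the infimum over an empty set of paths is [+oo]. *)
Lemma length_space_path (R : realType) (X : metricType R) (x y : X) :
  length_space X ->
  exists g : R -> X, [/\ {within `[0 : R, 1], continuous g}, g 0 = x & g 1 = y].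
Proof.
move=> /(_ x y); rewrite /path_dist.
have [-> |/set0P[g [gc g0 g1 _]] _] :=
  eqVneq (paths_in setT x y : set (R -> X)) set0.
  by rewrite image_set0 ereal_inf0.
by exists g.
Qed.

(** Intermediate value theorem for the distance to [x] along a path from [x] to [y]. *)
Lemma length_space_sphere (R : realType) (X : metricType R) (x y : X) (r : R) :
  length_space X -> 0 <= r <= mdist x y -> exists z, mdist x z = r.
Proof.
move=> Xl rxy; have [g [gc g0 g1]] := length_space_path x y Xl.
have [| |s _ <-] := @IVT R (mdist x \o g) 0 1 r ler01; last by exists (g s).
  move=> s; apply: (@continuous_comp (subspace `[0 : R, 1]) _ _ g (mdist x)).
    exact: gc.
  exact: mdist_continuous.
rewrite /= g0 g1 mdistxx; case/andP: rxy => r0 rxy.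
by rewrite ge_min r0 le_max rxy orbT.
Qed.

(** Uniform continuity by compactness of [0, 1], phrased for a subdivision into [m.+1] equal
    pieces. *)
Lemma path_unif_continuous (R : realType) (X : metricType R) (g : R -> X)
    (eta : R) : {within `[0 : R, 1], continuous g} -> 0 < eta ->
  exists m : nat, forall s u : R, 0 <= s <= 1 -> 0 <= u <= 1 ->
    `|s - u| * m.+1%:R <= 1 -> mdist (g s) (g u) < eta.
Proof.
move=> gc eta0.
pose P (e s : R) := forall u : R, 0 <= u <= 1 -> `|s - u| < e ->
  mdist (g s) (g u) < eta.
have : \forall e \near 0^'+, `[0 : R, 1]%classic `<=` P e.
  apply: (proj2 (near_covering_withinP _)).
    apply/compact_near_coveringP; exact: segment_compact.
  move=> x; rewrite /= in_itv/= => x01.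
  have [r r0 Hr] := within_continuous_ball gc x01 (divr_gt0 eta0 (ltr0n _ 2)).
  near=> x' e; rewrite /= in_itv/= => x'01 u u01 x'u.
  have xx' : `|x - x'| < r / 2.
    by near: x'; apply: nbhsx_ballx; rewrite divr_gt0.
  have er : e <= r / 2 by near: e; apply: nbhs_right_le; rewrite divr_gt0.
  have d1 : ball (g x) (eta / 2) (g x').
    by apply: Hr => //; rewrite (lt_trans xx')// gtr_pMr// invf_lt1 ?ltr1n.
  have d2 : ball (g x) (eta / 2) (g u).
    apply: Hr => //; rewrite (le_lt_trans (ler_distD x' x u))// (splitr r) ltrD//.
    exact: lt_le_trans er.
  move: d1 d2; rewrite ballEmdist/= => d1 d2.
  have := metric_triangle (g x') (g x) (g u).
  by rewrite (metric_sym (g x') (g x)) => ?; lra.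
move=> Pe.
have [e [e0 HP]] : exists e : R, 0 < e /\ `[0 : R, 1]%classic `<=` P e.
  near (0 : R)^'+ => e; exists e; split; first by near: e; exact: nbhs_right_gt.
  by near: e; exact: Pe.
exists (Num.truncn e^-1) => s u s01 u01 su.
apply: (HP s) => //=.
have m0 : 0 < (Num.truncn e^-1).+1%:R :> R by [].
rewrite -(ltr_pM2r m0) (le_lt_trans su)// -ltr_pdivrMl// mulr1.
by rewrite truncnS_gt.
Unshelve. all: by end_near. Qed.

(** A sphere around [q] of positive radius, smaller than the distance from [q] to every other point
    of [F], misses [F]; the point [y] makes it nonempty. *)
Lemma avoid_seq_near (R : realType) (X : metricType R) (q y : X) (F : seq X)
    (eta : R) :
  (forall (x y : X) (r : R), 0 <= r <= mdist x y -> exists z, mdist x z = r) ->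
  y != q -> 0 < eta -> exists2 z, z \notin F & mdist q z < eta.
Proof.
move=> spheres yq eta0.
have [|r r0 hr] := @fin_pos_lbound R 'I_(size F)
  (fun i => if nth q F i == q then 1 else mdist q (nth q F i)).
  by move=> i; case: ifPn => // Fi; rewrite mdist_gt0 eq_sym.
pose r' := Num.min (Num.min r eta) (mdist q y) / 2.
have [r'0 r'r r'e r'y] : [/\ 0 < r', r' < r, r' < eta & r' < mdist q y].
  have qy : 0 < mdist q y by rewrite mdist_gt0 eq_sym.
  have m0 : 0 < Num.min (Num.min r eta) (mdist q y) by rewrite !lt_min r0 eta0.
  have r'm : r' < Num.min (Num.min r eta) (mdist q y).
    by rewrite gtr_pMr// invf_lt1 ?ltr1n.
  split; first (by rewrite divr_gt0); apply: (lt_le_trans r'm);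
  by rewrite !ge_min ?lexx ?orbT.
have [|z zE] := spheres q y r'; first by rewrite !ltW.
exists z; last by rewrite zE.
apply/negP => zF; have zi : (index z F < size F)%N by rewrite index_mem.
have := hr (Ordinal zi); rewrite /= nth_index// zE; case: ifPn.
  by move=> /eqP zq; move: r'0; rewrite -zE zq mdistxx ltxx.
by rewrite leNgt r'r.
Qed.

Lemma distinct_approximants (R : realType) (X : metricType R) (I : finType)
    (q : I -> X) (F : seq X) (eta : R) :
  (forall (x y : X) (r : R), 0 <= r <= mdist x y -> exists z, mdist x z = r) ->
  (forall i, exists y, y != q i) -> 0 < eta ->
  exists c : I -> X, [/\ injective c, forall i, c i \notin F
    & forall i, mdist (q i) (c i) < eta].
Proof.
move=> spheres qy eta0.
suff H (r : seq I) : exists c : I -> X, [/\ {in r &, injective c},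
    forall i, i \in r -> c i \notin F
    & forall i, i \in r -> mdist (q i) (c i) < eta].
  have [c [ci cF cq]] := H (enum I).
  exists c; split=> [i j|i|i]; first by apply: ci; rewrite mem_enum.
  - by apply: cF; rewrite mem_enum.
  - by apply: cq; rewrite mem_enum.
elim: r => [|i r [c [ci cF cq]]]; first by exists q; split.
have [y yq] := qy i.
have [z zF zq] := avoid_seq_near (F ++ map c r) spheres yq eta0.
move: zF; rewrite mem_cat negb_or => /andP[zF zr].
have zc j : j \in r -> z <> c j.
  by move=> jr zE; move: zr; rewrite zE map_f.
exists (fun j => if j == i then z else c j); split.
- move=> j j'; rewrite !inE; have [->|ji] := eqVneq j i;
    have [->|ji'] := eqVneq j' i => //=.
  + by move=> _ /zc h /h.
  + by move=> /zc h _ /esym/h.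
  + exact: ci.
- by move=> j; rewrite inE; case: eqP => // _; exact: cF.
- by move=> j; rewrite inE; case: eqP => [->//|_]; exact: cq.
Qed.

(** * Maps with small fibers into dimension 2n + 1 *)

Lemma compact_ball_cover (R : realType) (X : pseudoMetricType R) (K : set X)
    (r : R) : compact K -> 0 < r ->
  exists L : seq X, forall y, K y -> exists2 c, c \in L & ball c r y.
Proof.
move=> /compact_near_coveringP Kc r0.
(* Finite lists ordered by inclusion generate a filter. Around each point all large enough lists
   work, and compactness yields one list for all of [K]. *)
pose F : set_system (seq X) :=
  filter_from setT (fun s : seq X => [set L : seq X | {subset s <= L}]).
have FF : Filter F.
  apply: filter_from_filter; first by exists [::].
  move=> s s' _ _; exists (s ++ s') => // L /= sL.
  by split=> x xs; apply: sL; rewrite mem_cat xs ?orbT.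
have [|L _ /(_ L (fun=> id)) LP] :=
  Kc _ F (fun L y => exists2 c, c \in L & ball c r y) FF.
  move=> x Kx; exists (ball x r, [set L : seq X | {subset [:: x] <= L}]).
    by split; [exact: nbhsx_ballx | exists [:: x]].
  by move=> [y L]/= [xy xL]; exists x => //; apply: xL; rewrite mem_head.
by exists L; exact: LP.
Qed.

(** By properness each shell [m <= mdist x0 y <= m.+1] is covered by finitely many small balls;
    keeping only centres at distance at least [m - 1] from [x0] makes the family locally finite. *)
Lemma small_ball_cover (R : realType) (X : metricType R) (delta : R) :
  proper_space X -> 0 < delta ->
  exists U : nat -> set X,
  [/\ forall i, open (U i), forall x, exists i, U i x,
      forall i x y, U i x -> U i y -> mdist x y < delta
    & forall x, exists N : nat, forall i, (N <= i)%N ->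
        forall y, mdist x y < 1 -> ~ U i y].
Proof.
move=> Xproper delta0.
have [[x0 _]|X0] := pselect (exists x0 : X, True); last first.
  exists (fun=> set0); split=> [i|x|//|x].
  - exact: open0.
  - by case: X0; exists x.
  - by case: X0; exists x.
pose r : R := Num.min (delta / 2) 1.
have r0 : 0 < r by rewrite lt_min divr_gt0/=.
have r1 : r <= 1 by rewrite ge_min lexx orbT.
have rd : r <= delta / 2 by rewrite ge_min lexx.
have ball_open (c : X) : open (ball c r).
  rewrite openE => y /=; rewrite ballEmdist/= => cy.
  apply/nbhs_ballP; exists (r - mdist c y) => [/=|z]; first by rewrite subr_gt0.
  rewrite !ballEmdist/= => yz.
  by rewrite (le_lt_trans (metric_triangle c y z))// addrC -ltrBrDr.
have covL (m : nat) : exists L : seq X,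
    (forall c, c \in L -> m%:R - 1 <= mdist x0 c) /\
    forall y, m%:R <= mdist x0 y <= m.+1%:R -> exists2 c, c \in L & ball c r y.
  have [L LK] := compact_ball_cover (Xproper x0 m.+1%:R) r0.
  exists [seq c <- L | m%:R - 1 <= mdist x0 c]; split=> [c|y /andP[my ym]].
    by rewrite mem_filter => /andP[].
  have [c cL cy] := LK y ym; exists c => //.
  rewrite mem_filter cL andbT.
  move: cy; rewrite ballEmdist/= => cy.
  by have := metric_triangle x0 c y; lra.
have [L HL] := choice covL.
(* The index encodes a shell and a position in its list; the other indices give the empty set. *)
pose U i : set X := if @pickle_inv (nat * nat)%type i is Some (m, j) then
  if (j < size (L m))%N then ball (nth x0 (L m) j) r else set0 else set0.
exists U; split.
- move=> i; rewrite /U; case: pickle_inv => [[m j]|]; last exact: open0.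
  by case: ifP => _; [exact: ball_open | exact: open0].
- move=> x; have [|c cL cx] := (HL (Num.truncn (mdist x0 x))).2 x.
    have := truncn_itv (mdist_ge0 x0 x); set k := Num.truncn _.
    by move=> /andP[-> /ltW ->].
  exists (pickle (Num.truncn (mdist x0 x), index c (L (Num.truncn (mdist x0 x))))).
  by rewrite /U pickleK_inv index_mem cL nth_index.
- move=> i x y; rewrite /U; case: pickle_inv => [[m j]|//]; case: ifP => // _.
  rewrite ballEmdist/=; set c := nth _ _ _ => cx cy.
  have := metric_triangle x c y; rewrite (metric_sym x c); lra.
(* A point within 1 of [x], in a ball of radius at most 1 whose centre is at distance at least
   [m - 1] from [x0], forces [m < mdist x0 x + 3]. *)
- move=> x; pose M := (Num.truncn (mdist x0 x + 3)).+1.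
  exists (\max_(m < M) \max_(j < size (L m)) (pickle ((m : nat), (j : nat))).+1)%N.
  move=> i Ni y xy; rewrite /U.
  case ui: (@pickle_inv (nat * nat)%type i) => [[m j]|]; last by [].
  case jL: (j < size (L m))%N; last by [].
  rewrite ballEmdist/=; set c := nth _ _ _ => cy.
  have mc : m%:R - 1 <= mdist x0 c by apply: (HL m).1; rewrite mem_nth.
  have mM : (m < M)%N.
    rewrite -(ltr_nat R) (@le_lt_trans _ _ (mdist x0 x + 3)) ?truncnS_gt//.
    have := metric_triangle x0 y c; have := metric_triangle x0 x y.
    rewrite (metric_sym y c); lra.
  move: Ni; rewrite leqNgt => /negP; apply.
  apply: (@leq_trans (\max_(j < size (L m)) (pickle (m, (j : nat))).+1)%N).
    have := @leq_bigmax _ (fun j : 'I_(size (L m)) => (pickle (m, (j : nat))).+1)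
      (Ordinal jL).
    by have := @pickle_invK (nat * nat)%type i; rewrite ui/= => ->.
  exact: (@leq_bigmax _ (fun m : 'I_M =>
    \max_(j < size (L m)) (pickle ((m : nat), (j : nat))).+1)%N (Ordinal mM)).
Qed.

(** A refinement of bounded order need not be locally finite. Merging its members that are assigned
    to the same [U i] makes it so, keeps the sets small, and does not raise the order. *)
Lemma finite_order_cover (R : realType) (X : metricType R) (n : nat) (delta : R) :
  proper_space X -> covering_dim_lt X n -> 0 < delta ->
  exists W : nat -> set X,
  [/\ forall i, open (W i), forall x, exists i, W i x,
      forall i x y, W i x -> W i y -> mdist x y < delta,
      forall x, exists N : nat, forall i, (N <= i)%N ->
        forall y, mdist x y < 1 -> ~ W i y
    & forall x, exists s : seq nat, (size s <= n)%N /\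
        forall i, W i x -> i \in s].
Proof.
move=> Xproper Xdim delta0.
have [U [Uopen Ucov Usmall Ufin]] := small_ball_cover Xproper delta0.
have [|V [[Vopen Vcov] VU Vord]] := Xdim (range U).
  split; first by move=> _ [i _ <-].
  by apply/seteqP; split=> // x _; have [i Uix] := Ucov x; exists (U i) => //; exists i.
have /choice[a Ha] : forall B, exists i, V B -> B `<=` U i.
  move=> B; have [VB|nVB] := pselect (V B); last by exists 0%N.
  by have [_ [i _ <-] BU] := VU _ VB; exists i.
pose W i := \bigcup_(B in [set B | V B /\ a B = i]) B.
have WU i : W i `<=` U i by move=> x [B [VB <-]]; exact: Ha.
exists W; split.
- by move=> i; apply: bigcup_open => B [/Vopen].
- move=> x; have : cover V id x by rewrite Vcov.
  by move=> [B VB Bx]; exists (a B); exists B.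
- by move=> i x y /WU Ux /WU; exact: Usmall.
- by move=> x; have [N HN] := Ufin x; exists N => i Ni y xy /WU; exact: HN.
- move=> x; exists (finmap.enum_fset (fset_set (a @` [set B | V B /\ B x]))).
  have fin := card_le_trans (card_image_le a [set B | V B /\ B x]) (Vord x).
  split; first exact: geq_card_fset_set fin.
  move=> i [B [VB aB] Bx].
  apply: (etrans (in_fset_set _ i)); last by apply/mem_set; exists B.
  by apply/finite_set_leP; exists n.
Qed.

(** The function is the distance to the complement of [W], capped at 1 so that it is finite even
    when [W] is the whole space. *)
Lemma open_bump (R : realType) (X : metricType R) (W : set X) : open W ->
  exists psi : X -> R, [/\ continuous psi, forall x, 0 <= psi x,
    forall x, W x -> 0 < psi x & forall x, ~ W x -> psi x = 0].
Proof.
move=> Wopen.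
pose E x := [set r : R | 0 <= r <= 1 /\ forall y, mdist x y < r -> W y].
have E0 x : E x 0.
  split=> [|y]; first by rewrite lexx ler01.
  by rewrite ltNge mdist_ge0.
have Esup x : has_sup (E x) by split; [exists 0 | exists 1 => r [/andP[]]].
have sup0 x : 0 <= sup (E x) by apply: ub_le_sup => //; case: (Esup x).
have Elip x y : sup (E x) - mdist x y <= sup (E y).
  rewrite lerBlDr; apply: ge_sup; first by exists 0.
  move=> r [/andP[r0 r1] Hr].
  have [rxy|rxy] := leP r (mdist x y).
    by rewrite (le_trans rxy)// lerDr.
  rewrite -lerBlDr; apply: ub_le_sup; first by case: (Esup y).
  split=> [|z yz].
    by rewrite subr_ge0 (ltW rxy)/= (le_trans _ r1)// gerBl mdist_ge0.
  by apply: Hr; rewrite (le_lt_trans (metric_triangle x y z))// addrC -ltrBrDr.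
exists (fun x => sup (E x)); split=> //.
- apply: lipschitz_continuous => x y; rewrite ler_norml.
  have := Elip x y; have := Elip y x; rewrite (metric_sym y x) => ? ?.
  by apply/andP; split; lra.
- move=> x Wx; have /nbhs_ballP[r r0 Hr] := open_nbhs_nbhs (conj Wopen Wx).
  have m0 : 0 < Num.min r 1 by rewrite lt_min r0 ltr01.
  apply: (lt_le_trans m0); apply: ub_le_sup; first by case: (Esup x).
  split=> [|y]; first by rewrite (ltW m0) ge_min lexx orbT.
  by rewrite lt_min => /andP[xy _]; apply: Hr; rewrite ballEmdist.
- move=> x Wx; apply/le_anti; rewrite sup0 andbT; apply: ge_sup; first by exists 0.
  move=> r [_ Hr]; rewrite leNgt; apply/negP => r0.
  by apply: Wx; apply: Hr; rewrite mdistxx.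
Qed.

(* Points of the moment curve with distinct parameters are in general
   position: this is the vanishing of a measure with few atoms and zero
   moments, tested against a polynomial that singles out one atom. *)
Lemma zero_moments (R : realType) (M m : nat) (s : seq nat) (c : nat -> R) :
  (size s <= m.+1)%N -> (forall i, i \notin s -> c i = 0) ->
  (forall j, (j <= m)%N -> \sum_(0 <= i < M) c i * i%:R ^+ j = 0) ->
  forall i, (i < M)%N -> c i = 0.
Proof.
move=> sm cs mom i0 i0M.
have [i0s|] := boolP (i0 \in s); last exact: cs.
pose q : {poly R} := \prod_(i <- rem i0 (undup s)) ('X - (i%:R)%:P).
have u0 : i0 \in undup s by rewrite mem_undup.
have qsize : (size q <= m.+1)%N.
  rewrite size_prod_XsubC size_rem// prednK ?(leq_trans (size_undup s))//.
  by case: (undup s) u0.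
have qE x : q.[x] = \prod_(i <- rem i0 (undup s)) (x - i%:R).
  by rewrite horner_prod; apply: eq_bigr => i _; rewrite hornerXsubC.
have qroot i : i \in s -> i != i0 -> q.[i%:R] = 0.
  move=> is_ ii0; apply/eqP; rewrite qE prodf_seq_eq0.
  apply/hasP; exists i; last by rewrite /= subrr.
  by rewrite mem_rem_uniq ?undup_uniq// inE ii0 mem_undup.
have q0 : q.[i0%:R] != 0.
  rewrite qE prodf_seq_neq0; apply/allP => i.
  rewrite mem_rem_uniq ?undup_uniq// inE => /andP[ii0 _].
  by rewrite /= subr_eq0 eqr_nat eq_sym.
have : \sum_(0 <= i < M) c i * q.[i%:R] = 0.
  under eq_bigr do rewrite (horner_coef_wide _ qsize) mulr_sumr.
  rewrite exchange_big/= big1// => j _.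
  under eq_bigr do rewrite mulrCA.
  by rewrite -mulr_sumr mom ?mulr0// -ltnS.
rewrite big_mkord (bigD1 (Ordinal i0M))//= big1 ?addr0.
  by move/eqP; rewrite mulf_eq0 (negbTE q0) orbF => /eqP.
move=> i ii0; have [is_|/cs->] := boolP (val i \in s); last by rewrite mul0r.
by rewrite qroot ?mulr0.
Qed.

(** [A] is the barycentric map with vertices (i, i^2, ..., i^(2n+1)). If [A x = A y], the difference
    of the weights has at most 2n+2 nonzero entries and vanishing moments of orders 0 to 2n+1, so it
    is zero and [x], [y] share some [W i]. *)
Lemma small_fiber_map (R : realType) (X : metricType R) (n : nat) (delta : R) :
  proper_space X -> covering_dim_lt X n.+1 -> 0 < delta ->
  exists2 A : X -> 'rV[R]_(2 * n + 1), continuous A &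
    forall x y, A x = A y -> mdist x y < delta.
Proof.
move=> Xproper Xdim delta0.
have [W [Wopen Wcov Wsmall Wfin Word]] := finite_order_cover Xproper Xdim delta0.
have [psi Hpsi] := choice (fun i => open_bump (Wopen i)).
have [N HN] := choice Wfin.
have psi0 x y i : (N x <= i)%N -> mdist x y < 1 -> psi i y = 0.
  by move=> Ni xy; have [_ _ _] := Hpsi i; apply; exact: HN xy.
pose S j x := \sum_(0 <= i < N x) psi i x * i%:R ^+ j.
(* The number of terms in [S j] depends on the point; it may be replaced by any bound past which the
   bumps vanish, hence by a constant near a given point. *)
have SE j y M : (forall i, (M <= i)%N -> psi i y = 0) ->
    S j y = \sum_(0 <= i < M) psi i y * i%:R ^+ j.
  have ext M1 M2 : (M1 <= M2)%N -> (forall i, (M1 <= i)%N -> psi i y = 0) ->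
      \sum_(0 <= i < M2) psi i y * i%:R ^+ j =
      \sum_(0 <= i < M1) psi i y * i%:R ^+ j.
    move=> M12 H1; rewrite (@big_cat_nat _ _ _ M1)//=.
    rewrite [X in _ + X]big_nat_cond [X in _ + X]big1 ?addr0//.
    by move=> i /andP[/andP[/H1-> _] _]; rewrite mul0r.
  move=> HM; have HNy i : (N y <= i)%N -> psi i y = 0.
    by move=> Ni; rewrite (psi0 y)// mdistxx.
  by have [le|/ltnW le] := leqP (N y) M;
    [rewrite (ext _ _ le) | rewrite /S (ext _ _ le)].
have Scont j : continuous (S j).
  move=> x; rewrite /continuous_at.
  have Snear : \forall y \near x,
      \sum_(0 <= i < N x) psi i y * i%:R ^+ j = S j y.
    near=> y; rewrite (@SE j y (N x))// => i Ni; apply: (psi0 x) => //.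
    by near: y; have := nbhsx_ballx x 1 ltr01; rewrite ballEmdist.
  apply: cvg_trans (near_eq_cvg Snear) _.
  apply: cvg_big => [|i _]; first exact: add_continuous.
  apply: cvgMr_tmp; have [psic _ _ _] := Hpsi i; exact: psic.
have S0 x : 0 < S 0%N x.
  have [i Wix] := Wcov x; have [_ _ /(_ x Wix) psii _] := Hpsi i.
  have iN : (i < N x)%N.
    by rewrite ltnNge; apply/negP => Ni; move: psii; rewrite (psi0 x) ?mdistxx ?ltxx.
  rewrite /S big_mkord (bigD1 (Ordinal iN))//= expr0 mulr1 ltr_pwDl//.
  by apply: sumr_ge0 => k _; rewrite mulr1; have [_ ->] := Hpsi k.
exists (fun x => \row_l (S l.+1 x / S 0%N x)).
  move=> x; apply: cvg_rV => l; rewrite mxE.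
  under eq_cvg do rewrite mxE.
  by apply: cvgM; [exact: Scont | apply: cvgV; [rewrite gt_eqF | exact: Scont]].
move=> x y Axy.
(* Order 0 is not a coordinate of [A]: it holds because the normalized weights sum to 1. *)
have Sxy j : (j <= 2 * n + 1)%N -> S j x / S 0%N x = S j y / S 0%N y.
  case: j => [_|j jn]; first by rewrite !mulfV// gt_eqF.
  by have := congr1 (fun v : 'rV_(2 * n + 1) => v ord0 (Ordinal jn)) Axy; rewrite !mxE.
have [sx [sxn Hsx]] := Word x; have [sy [syn Hsy]] := Word y.
pose c i := psi i x / S 0%N x - psi i y / S 0%N y.
have [i Wix] := Wcov x.
pose M := maxn (maxn (N x) (N y)) i.+1.
have c0 : c i = 0.
  apply: (@zero_moments R M (2 * n + 1) (sx ++ sy)).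
  - by rewrite size_cat (leq_trans (leq_add sxn syn))// addn1 mul2n -addnn addnS addSn.
  - move=> k; rewrite mem_cat negb_or => /andP[ksx ksy]; rewrite /c.
    have [_ _ _ Hk] := Hpsi k.
    rewrite !Hk ?mul0r ?subrr// => ?; [move: ksy | move: ksx];
    by rewrite ?Hsx ?Hsy.
  - move=> j /Sxy/eqP; rewrite -subr_eq0 => /eqP Sj0; rewrite -[RHS]Sj0.
    rewrite (@SE j x M) ?(@SE j y M).
    + rewrite !mulr_suml -sumrB.
      by apply: eq_bigr => k _; rewrite /c; ring.
    + move=> k kM; rewrite (psi0 y) ?mdistxx// (leq_trans _ kM)//.
      by rewrite /M !leq_max leqnn orbT.
    + move=> k kM; rewrite (psi0 x) ?mdistxx// (leq_trans _ kM)//.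
      by rewrite /M !leq_max leqnn.
  - by rewrite leq_max leqnn orbT.
have [_ _ /(_ x Wix) psix psiy] := Hpsi i.
apply: (Wsmall i) => //; apply: contrapT => /psiy psiy0.
move: c0; rewrite /c psiy0 mul0r subr0 => /eqP.
by rewrite gt_eqF// divr_gt0.
Unshelve. all: by end_near. Qed.

(** * Path distance in the graph *)

Lemma euclid_dist_lsubmx (R : realType) m n (p q : 'rV[R]_(m + n)) :
  euclid_dist (lsubmx p) (lsubmx q) <= euclid_dist p q.
Proof.
rewrite -{2}(hsubmxK p) -{2}(hsubmxK q) euclid_dist_row_mx.
rewrite -{1}(ger0_norm (euclid_dist_ge0 _ _)) -sqrtr_sqr ler_wsqrtr//.
by rewrite lerDl sqr_ge0.
Qed.

Lemma euclid_dist_rsubmx (R : realType) m n (p q : 'rV[R]_(m + n)) :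
  euclid_dist (rsubmx p) (rsubmx q) <= euclid_dist p q.
Proof.
rewrite -{2}(hsubmxK p) -{2}(hsubmxK q) euclid_dist_row_mx.
rewrite -{1}(ger0_norm (euclid_dist_ge0 _ _)) -sqrtr_sqr ler_wsqrtr//.
by rewrite lerDr sqr_ge0.
Qed.

(* The distance to the vertex [i], extended affinely to the edges, is
   1-Lipschitz on each of the two segments of every edge. *)
Lemma graph_path_length (R : realType) (k : nat) (w : 'I_k -> 'I_k -> R)
    (b : 'I_k -> 'I_k -> R -> 'rV[R]_3) (N : nat) (gam : R -> 'rV[R]_N)
    (beta : R -> 'rV[R]_3) (i j : 'I_k) :
  graph_embedding w b ->
  w i i = 0 -> (forall l l', `|w i l - w i l'| <= w l l') ->
  {within `[0 : R, 1], continuous beta} ->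
  beta 0 = b i i 0 -> beta 1 = b j j 0 ->
  (forall s : R, 0 <= s <= 1 ->
    exists l l' (u : R), 0 <= u <= 1 /\ beta s = b l l' u) ->
  (forall s u, euclid_dist (beta s) (beta u) <= euclid_dist (gam s) (gam u)) ->
  ((w i j)%:E <= path_length (@euclid_dist R N) gam)%E.
Proof.
move=> [bends bconst blip bhalf binj] wii wtri betac beta0 beta1 betab dbeta.
pose G l l' (u : R) : R := (1 - u) * w i l + u * w i l'.
have Gends l l' : G l l' 0 = w i l /\ G l l' 1 = w i l'.
  by rewrite /G subr0 subrr !mul1r !mul0r addr0 add0r.
have Gconst l u : G l l u = w i l by rewrite /G -mulrDl subrK mul1r.
(* Several parameters may give the same point; they give the same value by the last clause of
   [graph_embedding], applied to [G]. The default 0 is taken only off the graph. *)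
pose Phi v := xget 0 [set r | exists l l' (u : R),
  [/\ 0 <= u <= 1, v = b l l' u & r = G l l' u]].
have PhiE l l' (u : R) : 0 <= u <= 1 -> Phi (b l l' u) = G l l' u.
  move=> u01; rewrite /Phi; case: xgetP => [_ _ [m [m' [v [v01 bb ->]]]]|].
    by apply: (binj _ _ _ _ _ _ v01 u01 _ _ (w i)).
  by move=> /(_ (G l l' u)) []; exists l, l', u.
have itv0 : 0 <= (0 : R) <= 1 by rewrite lexx ler01.
have -> : w i j = `|Phi (beta 1) - Phi (beta 0)|.
  rewrite beta0 beta1 !PhiE// !(Gends _ _).1 wii subr0.
  by rewrite ger0_norm//; apply: le_trans (wtri i j).
apply: (@variation_le_path_length R _ _ gam (Phi \o beta)).
  exact: euclid_distC.
move=> s s01.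
pose half (h : bool) := if h then `[0 : R, 2^-1]%classic else `[2^-1 : R, 1]%classic.
pose S (q : 'I_k * 'I_k * bool) := b q.1.1 q.1.2 @` half q.2.
have Sclosed q : closed (S q).
  apply: compact_closed; first exact: norm_hausdorff.
  apply: continuous_compact.
    apply: continuous_subspaceT; exact: lipschitz_path_continuous (blip _ _).
  by rewrite /half; case: ifP => _; exact: segment_compact.
have halfP h (u : R) : half h u -> 0 <= u <= 1 /\ (if h then u <= 2^-1 else 2^-1 <= u).
  have h2 : 2^-1 <= 1 :> R by rewrite invf_le1 ?ler1n.
  have h0 : 0 <= 2^-1 :> R by [].
  rewrite /half; case: h; rewrite /= in_itv/= => /andP[a c].
    by rewrite a (le_trans c).
  by rewrite c (le_trans h0).
have Scov u : 0 <= u <= 1 -> exists q, S q (beta u).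
  move=> /betab[l [l' [v [/andP[v0 v1] ->]]]].
  have [v2|v2] := leP v 2^-1.
    by exists (l, l', true), v => //=; rewrite in_itv/= v0.
  by exists (l, l', false), v => //=; rewrite in_itv/= v1 ltW.
(* The half-edges are finitely many closed sets, so near [beta s] only those containing [beta s] are
   met. Hence [beta s] and a nearby [beta u] lie on a common segment. *)
have Snear q : \forall v \near beta s, S q v -> S q (beta s).
  have [Sqs|Sqs] := pselect (S q (beta s)); first by near=> v.
  have : \forall v \near beta s, (~` S q) v.
    by apply: open_nbhs_nbhs; split => //; exact: closed_openC.
  by apply: filterS => v.
have := filter_forall (nbhs_filter (beta s)) Snear.
move=> /nbhs_ballP[e e0 He].
have [r r0 Hr] := within_continuous_ball betac s01 e0.
exists r => // u u01 us.
have [q Squ] := Scov u u01.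
have Sqs : S q (beta s) by apply: He Squ; apply: Hr; rewrite // distrC.
apply: le_trans (dbeta _ _) => /=.
case: Squ => v /halfP[v01 v2] <-; case: Sqs => v' /halfP[v'01 v'2] <-.
rewrite !PhiE// bhalf; last first.
  by case: q.2 v2 v'2 => v2 v'2; [rewrite mulr_le0 | rewrite mulr_ge0]; lra.
rewrite (_ : G _ _ v - _ = (w i q.1.2 - w i q.1.1) * (v - v')); last first.
  by rewrite /G; ring.
by rewrite normrM ler_wpM2r// distrC.
Unshelve. all: by end_near. Qed.

(** * The map f *)

(* Cell [z] is a tiny ball around [c z] that will be mapped onto the portion
   [lo z, lo z + st z] of edge [e z]; the cells with [st z = 0] are centred at
   the vertices. *)
Lemma cell_centers (R : realType) (X : metricType R) (k : nat) (p : 'I_k -> X)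
    (eta : R) :
  length_space X -> injective p -> 0 < eta ->
  exists g : 'I_k -> 'I_k -> R -> X,
  [/\ forall i j, g i j 0 = p i /\ g i j 1 = p j,
      forall i s, g i i s = p i
    & exists (I : finType) (c : I -> X) (e : I -> 'I_k * 'I_k) (lo st : I -> R),
      [/\ injective c,
          forall z (u : R), 0 <= u <= 1 -> 0 <= lo z + u * st z <= 1 /\
            mdist (g (e z).1 (e z).2 (lo z + u * st z)) (c z) < 2 * eta,
          forall i, exists z, [/\ c z = p i, e z = (i, i), lo z = 0 & st z = 0]
        & forall i j (s : R), i != j -> 0 <= s <= 1 -> exists z z' (u : R),
            [/\ z != z', 0 <= u <= 1, e z = (i, j) & s = lo z + u * st z]]].
Proof.
move=> Xlen p_inj eta0.
have spheres := fun x y r => @length_space_sphere R X x y r Xlen.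
have /choice[g Hg] (ij : 'I_k * 'I_k) : exists g : R -> X,
    [/\ {within `[0 : R, 1], continuous g}, g 0 = p ij.1, g 1 = p ij.2
    & ij.1 = ij.2 -> forall s, g s = p ij.1].
  have [ij12|ij12] := eqVneq ij.1 ij.2.
    exists (fun=> p ij.1); split; rewrite ?ij12//.
    by apply: continuous_subspaceT => s; exact: cvg_cst.
  have [g [gc g0 g1]] := length_space_path (p ij.1) (p ij.2) Xlen.
  by exists g; split=> // ijE; move: ij12; rewrite ijE eqxx.
have /choice[mm Hmm] (ij : 'I_k * 'I_k) : exists m : nat,
    forall s u : R, 0 <= s <= 1 -> 0 <= u <= 1 ->
    `|s - u| * m.+1%:R <= 1 -> mdist (g ij s) (g ij u) < eta.
  by have [gc _ _ _] := Hg ij; exact: path_unif_continuous.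
pose M := \max_ij mm ij.
have HM ij (s u : R) : 0 <= s <= 1 -> 0 <= u <= 1 -> `|s - u| * M.+1%:R <= 1 ->
    mdist (g ij s) (g ij u) < eta.
  move=> s01 u01 su; apply: Hmm => //; apply: le_trans su.
  by rewrite ler_wpM2l// ler_nat ltnS /M leq_bigmax.
have M0 : 0 < M.+1%:R :> R by [].
exists (fun i j => g (i, j)); split.
- by move=> i j; have [_ -> -> _] := Hg (i, j).
- by move=> i s; have [_ _ _ ->] := Hg (i, i).
pose E := {ij : 'I_k * 'I_k | ij.1 != ij.2}.
(* Subdivision points of different paths may coincide, so the centres are distinct points near them
   that also avoid the vertices. Subdivision and perturbation each cost [eta]. *)
pose q (z : E * 'I_M.+1) : X := g (val z.1) (z.2%:R / M.+1%:R).
have qy z : exists y, y != q z.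
  have [pz|pz] := eqVneq (p (val z.1).1) (q z); last by exists (p (val z.1).1).
  by exists (p (val z.1).2); rewrite -pz (inj_eq p_inj) eq_sym; exact: (valP z.1).
have [c [c_inj cp cq]] :=
  @distinct_approximants R X _ q (map p (enum 'I_k)) eta spheres qy eta0.
have {}cp z i : c z <> p i.
  by move=> cz; have := cp z; rewrite cz map_f// mem_enum.
pose J : finType := ('I_k + E * 'I_M.+1)%type.
pose c' (z : J) : X := match z with inl i => p i | inr z => c z end.
pose e (z : J) := match z with inl i => (i, i) | inr z => val z.1 end.
pose lo (z : J) : R :=
  match z with inl i => 0 | inr z => z.2%:R / M.+1%:R end.
pose st (z : J) : R := match z with inl i => 0 | inr z => M.+1%:R^-1 end.
exists J, c', e, lo, st.
split.
- move=> [i|z] [i'|z'].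
  + by move/p_inj->.
  + by move/esym/cp.
  + by move/cp.
  + by move/c_inj->.
- move=> [i|z] u /andP[u0 u1] /=.
    rewrite mulr0 addr0 lexx ler01; split=> //.
    by have [_ -> _ _] := Hg (i, i); rewrite mdistxx mulr_gt0.
  have zM : z.2%:R + 1 <= M.+1%:R :> R by rewrite natr1 ler_nat.
  have z0 : 0 <= z.2%:R :> R by [].
  have uz01 : 0 <= (z.2%:R + u) / M.+1%:R <= 1.
    rewrite divr_ge0 ?addr_ge0 ?(ltW M0)//= ler_pdivrMr// mul1r.
    by apply: le_trans zM; rewrite lerD2l.
  have z01 : 0 <= (z.2%:R / M.+1%:R : R) <= 1.
    rewrite divr_ge0 ?(ltW M0)//= ler_pdivrMr// mul1r.
    by apply: le_trans zM; rewrite lerDl.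
  rewrite -mulrDl; split=> //.
  have d1 := cq z.
  have d2 : mdist (g (val z.1) ((z.2%:R + u) / M.+1%:R)) (q z) < eta.
    apply: HM => //; rewrite -mulrBl addrAC subrr add0r normrM.
    by rewrite !ger0_norm ?invr_ge0 ?(ltW M0)// mulfVK// gt_eqF.
  rewrite -surjective_pairing.
  have := metric_triangle (g (val z.1) ((z.2%:R + u) / M.+1%:R)) (q z) (c z).
  by move: d1 d2; lra.
- by move=> i; exists (inl i).
- move=> i j s ij /andP[s0 s1].
  have [l [u [u01 su]]] : exists (l : 'I_M.+1) (u : R),
      0 <= u <= 1 /\ s = l%:R / M.+1%:R + u * M.+1%:R^-1.
    (* For [s = 1] truncation would give the index [M.+1], out of range; the last piece with [u = 1]
       is used instead. *)
    have [sl1|s1'] := ltP s 1; last first.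
      exists ord_max, 1; rewrite ler01 lexx; split=> //.
      rewrite -mulrDl natr1 mulfV ?gt_eqF//.
      by apply/le_anti; rewrite s1 s1'.
    have sM0 : 0 <= s * M.+1%:R by rewrite mulr_ge0// ltW.
    have /andP[t0 t1] := truncn_itv sM0.
    have tM : (Num.truncn (s * M.+1%:R) < M.+1)%N.
      by rewrite -(ltr_nat R) (le_lt_trans t0)// gtr_pMl.
    exists (Ordinal tM), (s * M.+1%:R - (Num.truncn (s * M.+1%:R))%:R).
    split; first by rewrite subr_ge0 t0/= lerBlDl natr1 ltW.
    by rewrite -mulrDl addrC subrK mulfK// gt_eqF.
  have ijE : (i, j).1 != (i, j).2 by [].
  by exists (inr (exist _ (i, j) ijE, l)), (inl i), u.
Qed.

Lemma exact_distance_map (R : realType) (X : metricType R) (n : nat) (D : set X)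
    (delta : R) :
  proper_space X -> length_space X -> covering_dim_lt X n.+1 ->
  finite_set D -> 0 < delta ->
  exists f : X -> 'rV[R]_((2 * n + 1) + (3 + 1)),
    [/\ continuous f,
        forall x x' : X, f x = f x' -> mdist x x' < delta
      & forall x x' : X, D x -> D x' ->
          path_dist (@euclid_dist R _) (range f) (f x) (f x')
          = (mdist x x')%:E].
Proof.
move=> Xproper Xlen Xdim /finite_seqP[s0 DE] delta0.
pose sD := undup s0; pose k := size sD.
pose p (i : 'I_k) : X := tnth (in_tuple sD) i.
have p_inj : injective p by apply/tuple_uniqP; exact: undup_uniq.
have pD x : D x -> exists i, x = p i.
  rewrite DE /= -mem_undup => /(@tnthP _ _ (in_tuple sD))[i xi].
  by exists i.
pose w i j := mdist (p i) (p j).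
have wii i : w i i = 0 by exact: mdistxx.
have wgt0 i j : i != j -> 0 < w i j by move=> ij; rewrite mdist_gt0 (inj_eq p_inj).
have wtri i l l' : `|w i l - w i l'| <= w l l'.
  rewrite ler_norml /w; have := metric_triangle (p i) (p l) (p l').
  have := metric_triangle (p i) (p l') (p l); rewrite (metric_sym (p l') (p l)) => ? ?.
  by apply/andP; split; lra.
have [b bemb] := complete_graph_embedding wii wgt0.
have [bends bconst blip _ binj] := bemb.
(* Each of two identified points is within [2 * eta] plus [eta] of a common point on a path, and
   twice [3 * eta] is [delta]. *)
have eta0 : 0 < delta / 6 by rewrite divr_gt0.
have [g [gends gconst [I [c [e [lo [st [c_inj cells vcells ecells]]]]]]]] :=
  cell_centers Xlen p_inj eta0.
pose h z u := b (e z).1 (e z).2 (lo z + u * st z).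
have hcont z : continuous (h z).
  move=> u; rewrite /h; apply: (@continuous_comp _ _ _
    (fun v : R => lo z + v * st z) (b (e z).1 (e z).2)).
    by apply: cvgD; [exact: cvg_cst | apply: cvgMr_tmp; exact: cvg_id].
  exact: lipschitz_path_continuous (blip _ _) _.
have [B [t [[Bc tc] tcell tgraph tcen tonto]]] := graph_cells c_inj eta0 hcont
  (fun x y r => @length_space_sphere R X x y r Xlen).
have [A Ac Asmall] := small_fiber_map Xproper Xdim delta0.
(* The summand 1 keeps [M] positive even without edges of positive length, so the last coordinate
   always determines [t]. *)
pose M : R := 1 + \sum_i \sum_j w i j.
have w0 i j : 0 <= w i j by exact: mdist_ge0.
have wM i j : w i j <= M.
  rewrite /M (bigD1 i)//= (bigD1 j)//=.
  have : 0 <= \sum_(j0 | j0 != j) w i j0 by exact: sumr_ge0.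
  have : 0 <= \sum_(i0 | i0 != i) \sum_j0 w i0 j0.
    by apply: sumr_ge0 => i0 _; exact: sumr_ge0.
  lra.
have M0 : 0 < M by rewrite /M ltr_pwDl// sumr_ge0// => i _; exact: sumr_ge0.
pose f x : 'rV[R]_((2 * n + 1) + (3 + 1)) :=
  row_mx (t x *: A x) (row_mx (B x) (const_mx (M * t x))).
have vertex i : t (p i) = 0 /\ B (p i) = b i i 0.
  have [z [cz ez loz stz]] := vcells i; have [tz Bz] := tcen z.
  by rewrite -cz; split; rewrite // Bz /h ez loz stz mulr0 addr0.
have onto i j (s : R) : 0 <= s <= 1 -> exists x, t x = 0 /\ B x = b i j s.
  move=> s01; have [->|ij] := eqVneq i j.
    by exists (p j); rewrite bconst; exact: vertex.
  have [z [z' [u [zz' u01 ez ->]]]] := ecells i j s ij s01.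
  by have [x] := tonto z z' u zz' u01; rewrite /h ez; exists x.
have fend i : f (p i) = row_mx 0 (row_mx (b i i 0) 0).
  have [tp Bp] := vertex i; rewrite /f tp Bp scale0r mulr0.
  by congr (row_mx _ (row_mx _ _)); apply/rowP => l; rewrite !mxE.
pose pB (v : 'rV[R]_((2 * n + 1) + (3 + 1))) : 'rV[R]_3 := lsubmx (rsubmx v).
pose pt (v : 'rV[R]_((2 * n + 1) + (3 + 1))) : R := rsubmx (rsubmx v) ord0 ord0.
have pBf x : pB (f x) = B x by rewrite /pB row_mxKr row_mxKl.
have ptf x : pt (f x) = M * t x by rewrite /pt row_mxKr row_mxKr mxE.
exists f; split.
- move=> x; apply: cvg_rV => l.
  rewrite -[l](fintype.splitK l); case: (fintype.split l) => {}l /=.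
    under eq_cvg do rewrite row_mxEl mxE.
    rewrite row_mxEl mxE; apply: cvgM; first exact: tc.
    by apply: (@continuous_comp _ _ _ A (fun v : 'rV_(2 * n + 1) => v ord0 l));
      [exact: Ac | exact: coord_continuous].
  rewrite -[l](fintype.splitK l); case: (fintype.split l) => {}l /=.
    under eq_cvg do rewrite row_mxEr row_mxEl.
    rewrite row_mxEr row_mxEl.
    by apply: (@continuous_comp _ _ _ B (fun v : 'rV_3 => v ord0 l));
      [exact: Bc | exact: coord_continuous].
  under eq_cvg do rewrite !row_mxEr mxE.
  by rewrite !row_mxEr mxE; apply: cvgMl_tmp; exact: tc.
- move=> x x' fxx'.
  have txx' : t x = t x'.
    by apply: (mulfI (lt0r_neq0 M0)); rewrite -!ptf fxx'.
  have [tx0|tx0] := eqVneq (t x) 0; last first.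
    apply: Asmall; have := congr1 lsubmx fxx'; rewrite !row_mxKl -txx'.
    by move/(scalerI tx0).
  have [z [u [u01 zx Bx]]] := tcell x tx0.
  have [|z' [u' [u'01 z'x' Bx']]] := tcell x'; first by rewrite -txx'.
  have [v01 gz] := cells z u u01; have [v'01 gz'] := cells z' u' u'01.
  have Bxx' : B x = B x' by rewrite -!pBf fxx'.
  (* The last clause of the embedding, applied to the paths [g] in [X]: a common point of the graph
     corresponds to a single point of [X], near both centres. *)
  have gg := binj _ _ _ _ _ _ v01 v'01 (etrans (esym Bx) (etrans Bxx' Bx')) _ p g
    gends gconst.
  move: gz gz'; rewrite -gg; set y := g _ _ _ => yz yz'.
  have := metric_triangle x y x'; have := metric_triangle y (c z) x.
  have := metric_triangle y (c z') x'; rewrite (metric_sym x y).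
  by move: yz yz' zx z'x'; lra.
- move=> _ _ /pD[i ->] /pD[j ->].
  rewrite !fend; apply/le_anti/andP; split.
    (* Upper bound: the edge itself is a path in the image, lying over {t = 0}. *)
    pose gam s : 'rV[R]_((2 * n + 1) + (3 + 1)) :=
      row_mx 0 (row_mx (b i j s) 0).
    have dgam s u : euclid_dist (gam s) (gam u) = euclid_dist (b i j s) (b i j u).
      rewrite /gam !euclid_dist_row_mx !euclid_distxx !expr0n/= addr0 add0r.
      rewrite sqr_sqrtr ?sqr_ge0//.
      by rewrite sqrtr_sqr ger0_norm// euclid_dist_ge0.
    apply: (@le_trans _ _ (path_length (@euclid_dist R _) gam)).
      apply: ereal_inf_lbound; exists gam => //; split.
      + apply: continuous_subspaceT.
        by apply: (@lipschitz_path_continuous _ _ _ (w i j)) => s u; rewrite dgam.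
      + by rewrite /gam (bends i j).1.
      + by rewrite /gam (bends i j).2.
      + move=> _ [s s01 <-]; have [|x [tx Bx]] := onto i j s.
          by move: s01; rewrite /= in_itv.
        exists x => //; rewrite /f tx Bx scale0r mulr0 /gam.
        by congr (row_mx _ (row_mx _ _)); apply/rowP => l; rewrite !mxE.
    apply: path_length_le => s u s0' su u1; rewrite dgam.
    by rewrite (le_trans (blip _ _ _ _))// distrC ger0_norm// subr_ge0.
  apply: le_ereal_inf_tmp => _ [gam [gamc gam0 gam1 gamf] <-].
  have gamx (s : R) : 0 <= s <= 1 -> exists x, gam s = f x.
    move=> s01; have [|x _ <-] := gamf (gam s); last by exists x.
    by exists s => //=; rewrite in_itv.
  (* Lower bound: either the last coordinate reaches [M >= w i j], starting from 0, or [t < 1] along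
     the whole path and its [B]-block stays in the graph. *)
  have [[s [s01 Ms]]|low] := pselect (exists s : R, 0 <= s <= 1 /\ M <= pt (gam s)).
    have pt0 : pt (gam 0) = 0 by rewrite gam0 /pt !row_mxKr mxE.
    have s0' : 0 < s.
      rewrite lt_neqAle; have /andP[-> _] := s01; rewrite andbT.
      by apply/eqP => s0'; move: Ms; rewrite -s0' pt0 leNgt M0.
    have /andP[_ s1] := s01.
    apply: le_trans (@dist_le_path_length R _ (@euclid_dist R _) gam s
      (@euclid_dist_ge0 R _) s0' s1).
    rewrite lee_fin (le_trans (wM i j))// (le_trans Ms)//.
    apply: le_trans (euclid_dist_rsubmx _ _).
    apply: le_trans (euclid_dist_rsubmx _ _).
    apply: le_trans (coord_le_euclid_dist _ _ ord0).
    by rewrite -/(pt _) -/(pt _) pt0 sub0r normrN ler_norm.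
  apply: (@graph_path_length R k w b _ gam (pB \o gam)) => //.
  + move=> s; apply: cvg_rV => l.
    rewrite /comp/=; under eq_cvg do rewrite !mxE.
    rewrite !mxE.
    apply: (@continuous_comp (subspace `[0 : R, 1]) _ _ gam
      (fun v : 'rV_((2 * n + 1) + (3 + 1)) => v ord0 (rshift _ (lshift _ l)))).
      exact: gamc.
    exact: coord_continuous.
  + by rewrite /= gam0 /pB row_mxKr row_mxKl.
  + by rewrite /= gam1 /pB row_mxKr row_mxKl.
  + move=> s s01; have [x gx] := gamx s s01.
    have [|z [u [u01 Bx]]] := tgraph x.
      rewrite ltNge; apply/negP => tx; apply: low; exists s; split=> //.
      by rewrite gx ptf ler_peMr// ltW.
    exists (e z).1, (e z).2, (lo z + u * st z); split.
      by have [] := cells z u u01.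
    by rewrite /= gx pBf.
  + move=> s u; apply: le_trans (euclid_dist_rsubmx _ _).
    exact: euclid_dist_lsubmx.
Qed.

Theorem lemma3 (R : realType) (X : metricType R) (n : nat) (D : set X)
    (delta : R)
    (Xproper : proper_space X) (Xlength : length_space X)
    (Xdim : has_covering_dim X n) (Dfin : finite_set D)
    (delta_gt0 : 0 < delta) :
  exists f : X -> 'rV[R]_(2 * n + 5),
    [/\ continuous f,
        forall x x' : X, f x = f x' -> mdist x x' < delta
      & forall x x' : X, D x -> D x' ->
          path_dist (@euclid_dist R (2 * n + 5)) (range f) (f x) (f x')
          = (mdist x x')%:E].
Proof.
have -> : (2 * n + 5)%N = ((2 * n + 1) + (3 + 1))%N by rewrite -addnA.
exact: exact_distance_map Xproper Xlength Xdim.1 Dfin delta_gt0.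
Qed.
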